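(* $E^{ce}_{\mathrm{Cof}}\equiv_cE^{ce}_{\mathrm{set}}\equiv_cE^2_=$, i.e. these three equivalence relations are pairwise computably bireducible.
   Context: $W_e$ is the $e$-th c.e. set and $W_e^{\emptyset''}$ the $e$-th set c.e. in $\emptyset''$; $A^{[n]}=\{x:\langle x,n\rangle\in A\}$ is the $n$-th column of $A\subseteq\omega$ under the standard pairing function. $i\,E^{ce}_{\mathrm{Cof}}\,j\iff$ for every $n$, $W_i^{[n]}$ is cofinite iff $W_j^{[n]}$ is cofinite. $i\,E^{ce}_{\mathrm{set}}\,j\iff\{W_i^{[n]}:n\in\omega\}=\{W_j^{[n]}:n\in\omega\}$. $i\,E^2_=\,j\iff W_i^{\emptyset''}=W_j^{\emptyset''}$. $E\leq_cF$ means there is a total computable $g$ with $x\,E\,y\iff g(x)\,F\,g(y)$ for all $x,y$; $E\equiv_cF$ means $E\leq_cF$ and $F\leq_cE$. *)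

(* Defs.v *)
From HB Require Import structures.
From mathcomp Require Import all_boot.
Set Implicit Arguments. Unset Strict Implicit. Unset Printing Implicit Defensive.

Definition pair (x y : nat) : nat := (x + y) * (x + y).+1 %/ 2 + y.

Fixpoint unpair_aux (s z : nat) : nat * nat :=
  (* z < (s+1)(s+2)/2 is invariant when called on the right diagonal *)
  match s with
  | 0 => (0, 0)
  | s'.+1 => if s * s.+1 %/ 2 <= z then (s - (z - s * s.+1 %/ 2), z - s * s.+1 %/ 2)
             else unpair_aux s' z
  end.
Definition unpair (z : nat) : nat * nat := unpair_aux z z.
Definition fst' z := (unpair z).1.
Definition snd' z := (unpair z).2.

Inductive code : Type :=
| CZero
| CSucc
| CId
| CFst
| CSnd
| COracle
| CPair of code & code
| CComp of code & code
| CPrim of code & code       (* h<0,y> = f y ; h<n+1,y> = g <n, <h<n,y>, y>> *)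
| CMu of code.               (* x |-> least n with f<n,x> = 0 (all earlier defined) *)

Inductive eval (A : nat -> Prop) : code -> nat -> nat -> Prop :=
| evZero x : eval A CZero x 0
| evSucc x : eval A CSucc x x.+1
| evId x : eval A CId x x
| evFst x : eval A CFst x (fst' x)
| evSnd x : eval A CSnd x (snd' x)
| evOracle1 x : A x -> eval A COracle x 1
| evOracle0 x : ~ A x -> eval A COracle x 0
| evPair f g x a b : eval A f x a -> eval A g x b -> eval A (CPair f g) x (pair a b)
| evComp f g x y z : eval A g x y -> eval A f y z -> eval A (CComp f g) x z
| evPrim0 f g y z : eval A f y z -> eval A (CPrim f g) (pair 0 y) z
| evPrimS f g n y r z : eval A (CPrim f g) (pair n y) r ->
    eval A g (pair n (pair r y)) z -> eval A (CPrim f g) (pair n.+1 y) z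
| evMu f x n : eval A f (pair n x) 0 ->
    (forall m, m < n -> exists k, eval A f (pair m x) k.+1) ->
    eval A (CMu f) x n.

(* Goedel numbering of codes, via MathComp's generic countable encoding. *)
Fixpoint code_to_tree (c : code) : GenTree.tree nat :=
  match c with
  | CZero => GenTree.Node 0 [::]
  | CSucc => GenTree.Node 1 [::]
  | CId => GenTree.Node 2 [::]
  | CFst => GenTree.Node 3 [::]
  | CSnd => GenTree.Node 4 [::]
  | COracle => GenTree.Node 5 [::]
  | CPair f g => GenTree.Node 6 [:: code_to_tree f; code_to_tree g]
  | CComp f g => GenTree.Node 7 [:: code_to_tree f; code_to_tree g]
  | CPrim f g => GenTree.Node 8 [:: code_to_tree f; code_to_tree g]
  | CMu f => GenTree.Node 9 [:: code_to_tree f]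
  end.

Fixpoint tree_to_code (t : GenTree.tree nat) : option code :=
  match t with
  | GenTree.Node 0 [::] => Some CZero
  | GenTree.Node 1 [::] => Some CSucc
  | GenTree.Node 2 [::] => Some CId
  | GenTree.Node 3 [::] => Some CFst
  | GenTree.Node 4 [::] => Some CSnd
  | GenTree.Node 5 [::] => Some COracle
  | GenTree.Node 6 [:: t1; t2] =>
      if (tree_to_code t1, tree_to_code t2) is (Some f, Some g) then Some (CPair f g) else None
  | GenTree.Node 7 [:: t1; t2] =>
      if (tree_to_code t1, tree_to_code t2) is (Some f, Some g) then Some (CComp f g) else None
  | GenTree.Node 8 [:: t1; t2] =>
      if (tree_to_code t1, tree_to_code t2) is (Some f, Some g) then Some (CPrim f g) else None
  | GenTree.Node 9 [:: t1] =>
      if tree_to_code t1 is Some f then Some (CMu f) else None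
  | _ => None
  end.

Lemma code_treeK : pcancel code_to_tree tree_to_code.
Proof. by elim=> //= f -> // g ->. Qed.

HB.instance Definition _ := PCanIsCountable code_treeK.

(* The e-th program (invalid numbers default to the program CZero). *)
Definition prog (e : nat) : code := odflt CZero (unpickle e).

Definition W (A : nat -> Prop) (e : nat) : nat -> Prop :=
  fun x => exists y, eval A (prog e) x y.

Definition emptyset : nat -> Prop := fun _ => False.

Definition Wce (e : nat) : nat -> Prop := W emptyset e.

Definition jump (A : nat -> Prop) : nat -> Prop := fun e => W A e e.
Definition zero2 : nat -> Prop := jump (jump emptyset).

Definition column (S : nat -> Prop) (n : nat) : nat -> Prop := fun x => S (pair x n).

Definition cofinite (S : nat -> Prop) : Prop := exists m, forall x, m <= x -> S x.

Definition set_eq (S T : nat -> Prop) : Prop := forall x, S x <-> T x.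

Definition E_Cof (i j : nat) : Prop :=
  forall n, cofinite (column (Wce i) n) <-> cofinite (column (Wce j) n).

Definition E_set (i j : nat) : Prop :=
  (forall n, exists m, set_eq (column (Wce i) n) (column (Wce j) m)) /\
  (forall m, exists n, set_eq (column (Wce i) n) (column (Wce j) m)).

Definition E2_eq (i j : nat) : Prop := set_eq (W zero2 i) (W zero2 j).

Definition computable (g : nat -> nat) : Prop :=
  exists c : code, forall x, eval emptyset c x (g x).

Definition creducible (E F : nat -> nat -> Prop) : Prop :=
  exists g, computable g /\ forall x y, E x y <-> F (g x) (g y).

Definition cbireducible (E F : nat -> nat -> Prop) : Prop :=
  creducible E F /\ creducible F E.

(* Main.v *)
Require Import Defs.
From mathcomp Require Import all_boot zify.
From Stdlib Require Import Classical ClassicalEpsilon.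
Set Implicit Arguments. Unset Strict Implicit. Unset Printing Implicit Defensive.

(** The sets c.e. in the double jump of the empty set are, uniformly in their
    index, the sets [{n | exists k, forall a, R n k a}] with [R] c.e.: Post's
    theorem [x \in W (jump A) e <-> exists k, ~ jump A (q e x k)], with [q]
    computable, applied for [A = 0'] and [A = 0]. It rests on a stack machine
    interpreting the codes, whose oracle is a finite list, so that a halting
    computation is witnessed by a number.

    E_Cof and E_set reduce to E2_eq, as [{n | column n of W_i is cofinite}] and
    [{e | W_e is a column of W_i}] are of this form.

    Conversely, let [S = {n | exists k, forall a, R n k a}].
    - For E_set, the columns are all finite sets [{<y, n> | y < m}] together with
      [{<y, n> | forall a <= y, R n k a}] for all [n] and [k]: their collection is
      that of all finite segments, plus the full line [{<y, n> | y}] for [n \in S].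
    - For E_Cof, there is a computable [f] such that [f s = k] for infinitely many
      [s] iff [forall a, R n k a]; then [{x | exists s > x, f s <= f x}] is cofinite
      iff [f] does not tend to infinity, i.e., iff [n \in S]. *)

(** * Pairing *)

Lemma tri_succ s : s.+1 * s.+2 %/ 2 = s * s.+1 %/ 2 + s.+1.
Proof.
have -> : s.+1 * s.+2 = s * s.+1 + s.+1 * 2 by lia.
by rewrite addnC divnMDl // addnC.
Qed.

Lemma leq_tri s : s <= s * s.+1 %/ 2.
Proof. by elim: s => [|s IH] //; rewrite tri_succ; lia. Qed.

Lemma unpair_aux_pair x y s : x + y <= s -> unpair_aux s (pair x y) = (x, y).
Proof.
elim: s => [|s IH]; first by rewrite leqn0 addn_eq0 => /andP[/eqP-> /eqP->].
rewrite leq_eqVlt => /orP[/eqP E|lt_s].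
  have -> : pair x y = s.+1 * s.+2 %/ 2 + y by rewrite /pair E.
  by cbn [unpair_aux]; rewrite leq_addr addKn -E addnK.
have T : (x + y) * (x + y).+1 %/ 2 + (x + y).+1 <= s.+1 * s.+2 %/ 2.
  by rewrite -tri_succ leq_div2r // leq_mul.
cbn [unpair_aux]; rewrite ifF ?IH // /pair; lia.
Qed.

Lemma unpairK x y : unpair (pair x y) = (x, y).
Proof. apply: unpair_aux_pair; rewrite /pair; have := leq_tri (x + y); lia. Qed.

Lemma fst_pair x y : fst' (pair x y) = x. Proof. by rewrite /fst' unpairK. Qed.
Lemma snd_pair x y : snd' (pair x y) = y. Proof. by rewrite /snd' unpairK. Qed.

Lemma pair_surj_aux s z : z < s.+1 * s.+2 %/ 2 ->
  pair (unpair_aux s z).1 (unpair_aux s z).2 = z.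
Proof.
elim: s => [|s IH]; first by case: z.
rewrite tri_succ; cbn [unpair_aux] => lt.
case: (leqP (s.+1 * s.+2 %/ 2) z) => le; last exact: IH.
rewrite /pair; cbn [fst snd]; rewrite subnK; lia.
Qed.

Lemma pair_surj z : pair (fst' z) (snd' z) = z.
Proof. by apply: pair_surj_aux; rewrite tri_succ; have := leq_tri z; lia. Qed.

Lemma leq_pairl x y : x <= pair x y.
Proof. by rewrite /pair; have := leq_tri (x + y); lia. Qed.
Lemma leq_pairr x y : y <= pair x y.
Proof. by rewrite /pair leq_addl. Qed.

#[global] Opaque pair fst' snd'.
Definition pairE := (fst_pair, snd_pair).

(** * Functions computable in an oracle *)

(** [CPrim] evaluates at arguments of the form [pair n y], which is not a constructor pattern;
    inverting through [fst'] and [snd'] avoids equations between pairs. *)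
Lemma eval_inv A c x y : eval A c x y ->
  match c with
  | CZero => y = 0
  | CSucc => y = x.+1
  | CId => y = x
  | CFst => y = fst' x
  | CSnd => y = snd' x
  | COracle => A x /\ y = 1 \/ ~ A x /\ y = 0
  | CPair f g => exists a b, [/\ eval A f x a, eval A g x b & y = pair a b]
  | CComp f g => exists2 z, eval A g x z & eval A f z y
  | CPrim f g =>
      if fst' x is n.+1 then
        exists2 r, eval A (CPrim f g) (pair n (snd' x)) r &
                   eval A g (pair n (pair r (snd' x))) y
      else eval A f (snd' x) y
  | CMu f => eval A f (pair y x) 0 /\
      forall m, m < y -> exists k, eval A f (pair m x) k.+1
  end.
Proof.
case=> //=; rewrite ?pairE //; try by auto.
- by move=> f g {}x a b; exists a, b.
- by move=> f g {}x u z; exists u.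
- by move=> f g w z; rewrite !pairE.
- by move=> f g n w r z; rewrite !pairE; exists r.
Qed.

(** The induction is on the code, since the second premise of [evMu] hides its evaluations under an
    existential, where induction on the derivation gives no hypothesis. *)
Lemma eval_det A c x y z : eval A c x y -> eval A c x z -> y = z.
Proof.
elim: c x y z => [|||||| f IHf g IHg | f IHf g IHg | f IHf g IHg | f IHf] x y z.
1-5: by move=> /eval_inv-> /eval_inv->.
- by move=> /eval_inv[] [? ->] /eval_inv[] [? ->].
- move=> /eval_inv[a [b [Ha Hb ->]]] /eval_inv[a' [b' [Ha' Hb' ->]]].
  by rewrite (IHf _ _ _ Ha Ha') (IHg _ _ _ Hb Hb').
- move=> /eval_inv[a Ha Hb] /eval_inv[a' Ha' Hb'].
  by move: Hb'; rewrite -(IHg _ _ _ Ha Ha') => /(IHf _ _ _ Hb).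
- rewrite -(pair_surj x); move: (fst' x) (snd' x) => n w {x}.
  elim: n y z => [|n IHn] y z /eval_inv H1 /eval_inv; move: H1; rewrite !pairE.
    exact: IHf.
  by move=> [r Hr Hy] [r' /(IHn _ _ Hr) <-]; apply: IHg.
- move=> /eval_inv[Z1 L1] /eval_inv[Z2 L2].
  case: (ltngtP y z) => // [/L2|/L1] [k E].
    by have := IHf _ _ _ Z1 E.
  by have := IHf _ _ _ Z2 E.
Qed.

Definition rec_in (A : nat -> Prop) (f : nat -> nat) : Prop :=
  exists c, forall x, eval A c x (f x).

Section RecBasics.
Variable A : nat -> Prop.

Lemma rec_in_ext f g : f =1 g -> rec_in A f -> rec_in A g.
Proof. by move=> E [c H]; exists c => x; rewrite -E. Qed.

Lemma rec_in_id : rec_in A (fun x => x).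
Proof. by exists CId => x; constructor. Qed.

Lemma rec_in_comp f g : rec_in A f -> rec_in A g -> rec_in A (fun x => f (g x)).
Proof. by case=> c Hc [d Hd]; exists (CComp c d) => x; econstructor; eauto. Qed.

Lemma rec_in_S f : rec_in A f -> rec_in A (fun x => (f x).+1).
Proof. by apply: rec_in_comp; exists CSucc => x; constructor. Qed.

Lemma rec_in_const n : rec_in A (fun _ => n).
Proof. by elim: n => [|n]; [exists CZero => x; constructor | exact: rec_in_S]. Qed.

Lemma rec_in_fst f : rec_in A f -> rec_in A (fun x => fst' (f x)).
Proof. by apply: rec_in_comp; exists CFst => x; constructor. Qed.

Lemma rec_in_snd f : rec_in A f -> rec_in A (fun x => snd' (f x)).
Proof. by apply: rec_in_comp; exists CSnd => x; constructor. Qed.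

Lemma rec_in_pair f g : rec_in A f -> rec_in A g -> rec_in A (fun x => pair (f x) (g x)).
Proof. by case=> c Hc [d Hd]; exists (CPair c d) => x; constructor. Qed.

(** The step is coded on [pair i (pair r x)]: counter, accumulator, parameter, in the order in which
    [CPrim] supplies them. *)
Lemma rec_in_iteri n b (s : nat -> nat -> nat -> nat) :
  rec_in A n -> rec_in A b ->
  rec_in A (fun z => s (snd' (snd' z)) (fst' z) (fst' (snd' z))) ->
  rec_in A (fun x => iteri (n x) (s x) (b x)).
Proof.
case=> cn Hn [cb Hb] [cs Hs]; exists (CComp (CPrim cb cs) (CPair cn CId)) => x.
apply: evComp; first by apply: evPair; [exact: Hn | exact: evId].
elim: (n x) => [|i IH]; first by constructor.
apply: evPrimS IH _; have := Hs (pair i (pair (iteri i (s x) (b x)) x)).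
by rewrite !pairE.
Qed.

End RecBasics.

Ltac rec_core := fail.
Ltac rec_user := fail.
Ltac rec_step :=
  cbv beta;
  lazymatch goal with
  | |- rec_in _ (fun x => x) => apply rec_in_id
  | |- rec_in _ (fun _ => ?c) => apply rec_in_const
  | |- rec_in _ fst' => apply (rec_in_fst (rec_in_id _))
  | |- rec_in _ snd' => apply (rec_in_snd (rec_in_id _))
  | |- rec_in _ S => apply (rec_in_S (rec_in_id _))
  | |- rec_in _ (fun x => S (@?f x)) => apply (@rec_in_S _ f)
  | |- rec_in _ (fun x => fst' (@?f x)) => apply (@rec_in_fst _ f)
  | |- rec_in _ (fun x => snd' (@?f x)) => apply (@rec_in_snd _ f)
  | |- rec_in _ (fun x => pair (@?f x) (@?g x)) => apply (@rec_in_pair _ f g)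
  | |- rec_in _ (fun x => iteri (@?n x) (@?s x) (@?b x)) => apply (@rec_in_iteri _ n b s)
  | _ => first [ assumption
      | match goal with
        | H : rec_in ?A ?F |- rec_in ?A (fun x => ?F (@?g x)) => apply (@rec_in_comp A F g H)
        | H : forall B, rec_in B ?F |- rec_in ?A (fun x => ?F (@?g x)) =>
            apply (@rec_in_comp A F g (H A))
        | H : forall B, rec_in B ?F |- rec_in ?A ?F => apply (H A)
        end
      | rec_user | rec_core ]
  end.
Ltac solve_rec := repeat rec_step.

(** * Closure under arithmetic, Boolean operations and bounded search *)

Section RecArith.
Variable A : nat -> Prop.
Implicit Types f g : nat -> nat.

Lemma rec_in_pred f : rec_in A f -> rec_in A (fun x => (f x).-1).
Proof.
move=> H; apply: (@rec_in_ext _ (fun x => iteri (f x) (fun i _ => i) 0)); last by solve_rec.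
by move=> x; case: (f x).
Qed.

Lemma rec_in_iter n (s : nat -> nat -> nat) b : rec_in A n -> rec_in A b ->
  rec_in A (fun z => s (snd' (snd' z)) (fst' (snd' z))) ->
  rec_in A (fun x => iter (n x) (s x) (b x)).
Proof.
move=> Hn Hb Hs; apply: (@rec_in_ext _ (fun x => iteri (n x) (fun _ r => s x r) (b x))).
  by move=> x; elim: (n x) => //= k ->.
by solve_rec.
Qed.

Lemma rec_in_add f g : rec_in A f -> rec_in A g -> rec_in A (fun x => f x + g x).
Proof.
move=> Hf Hg.
apply: (@rec_in_ext _ (fun x => iteri (g x) (fun _ r => r.+1) (f x))); last by solve_rec.
by move=> x; elim: (g x) => [|n] /=; rewrite ?addn0 ?addnS // => ->.
Qed.

Lemma rec_in_sub f g : rec_in A f -> rec_in A g -> rec_in A (fun x => f x - g x).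
Proof.
move=> Hf Hg; apply: (@rec_in_ext _ (fun x => iter (g x) predn (f x))).
  by move=> x; elim: (g x) => [|n] /=; rewrite ?subn0 ?subnS // => ->.
by apply: rec_in_iter => //; apply: rec_in_pred; solve_rec.
Qed.

Lemma rec_in_mul f g : rec_in A f -> rec_in A g -> rec_in A (fun x => f x * g x).
Proof.
move=> Hf Hg; apply: (@rec_in_ext _ (fun x => iteri (g x) (fun _ r => r + f x) 0)).
  by move=> x; elim: (g x) => [|n] /=; rewrite ?muln0 ?mulnSr // => ->.
by solve_rec; apply: rec_in_add; solve_rec.
Qed.

Lemma rec_in_exp f g : rec_in A f -> rec_in A g -> rec_in A (fun x => f x ^ g x).
Proof.
move=> Hf Hg; apply: (@rec_in_ext _ (fun x => iteri (g x) (fun _ r => f x * r) 1)).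
  by move=> x; elim: (g x) => [|n] /=; rewrite ?expn0 ?expnS // => ->.
by solve_rec; apply: rec_in_mul; solve_rec.
Qed.

Lemma rec_in_if (b : nat -> bool) f g : rec_in A (fun x => b x) -> rec_in A f -> rec_in A g ->
  rec_in A (fun x => if b x then f x else g x).
Proof.
move=> Hb Hf Hg; apply: (@rec_in_ext _ (fun x => iteri (b x) (fun _ _ => f x) (g x))).
  by move=> x; case: (b x).
by solve_rec.
Qed.

Lemma rec_in_eq0 f : rec_in A f -> rec_in A (fun x => f x == 0).
Proof.
move=> Hf; apply: (@rec_in_ext _ (fun x => iteri (f x) (fun _ _ => 0) 1)); last by solve_rec.
by move=> x; case: (f x).
Qed.

Lemma rec_in_leq f g : rec_in A f -> rec_in A g -> rec_in A (fun x => f x <= g x).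
Proof. by move=> Hf Hg; apply: rec_in_eq0; apply: rec_in_sub. Qed.

Lemma rec_in_if_bool (b c d : nat -> bool) :
  rec_in A (fun x => b x) -> rec_in A (fun x => c x) -> rec_in A (fun x => d x) ->
  rec_in A (fun x => if b x then c x else d x).
Proof.
move=> Hb Hc Hd; apply: rec_in_ext (rec_in_if Hb Hc Hd) => x; by case: (b x).
Qed.

Lemma rec_in_and (b c : nat -> bool) :
  rec_in A (fun x => b x) -> rec_in A (fun x => c x) -> rec_in A (fun x => b x && c x).
Proof. by move=> Hb Hc; apply: (rec_in_if_bool Hb Hc (d := fun _ => false)); solve_rec. Qed.

Lemma rec_in_or (b c : nat -> bool) :
  rec_in A (fun x => b x) -> rec_in A (fun x => c x) -> rec_in A (fun x => b x || c x).
Proof. by move=> Hb Hc; apply: (rec_in_if_bool Hb (c := fun _ => true) _ Hc); solve_rec. Qed.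

Lemma rec_in_neg (b : nat -> bool) :
  rec_in A (fun x => b x) -> rec_in A (fun x => ~~ b x).
Proof.
by move=> Hb; apply: (rec_in_if_bool Hb (c := fun _ => false) (d := fun _ => true)); solve_rec.
Qed.

Lemma rec_in_eq f g : rec_in A f -> rec_in A g -> rec_in A (fun x => f x == g x).
Proof.
move=> Hf Hg; apply: (@rec_in_ext _ (fun x => (f x <= g x) && (g x <= f x))).
  by move=> x; rewrite eqn_leq.
by apply: rec_in_and; apply: rec_in_leq.
Qed.

End RecArith.

Ltac rec_core ::=
  lazymatch goal with
  | |- rec_in _ (fun x => predn (@?f x)) => apply (@rec_in_pred _ f)
  | |- rec_in _ (fun x => iter (@?n x) (@?s x) (@?b x)) => apply (@rec_in_iter _ n s b)
  | |- rec_in _ (fun x => addn (@?f x) (@?g x)) => apply (@rec_in_add _ f g)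
  | |- rec_in _ (fun x => subn (@?f x) (@?g x)) => apply (@rec_in_sub _ f g)
  | |- rec_in _ (fun x => muln (@?f x) (@?g x)) => apply (@rec_in_mul _ f g)
  | |- rec_in _ (fun x => expn (@?f x) (@?g x)) => apply (@rec_in_exp _ f g)
  | |- rec_in _ (fun x => nat_of_bool (leq (@?f x) (@?g x))) => apply (@rec_in_leq _ f g)
  | |- rec_in _ (fun x => nat_of_bool (@eq_op _ (@?f x) (@?g x))) => apply (@rec_in_eq _ f g)
  | |- rec_in _ (fun x => nat_of_bool (~~ (@?b x))) => apply (@rec_in_neg _ b)
  | |- rec_in _ (fun x => nat_of_bool ((@?b x) && (@?c x))) => apply (@rec_in_and _ b c)
  | |- rec_in _ (fun x => nat_of_bool ((@?b x) || (@?c x))) => apply (@rec_in_or _ b c)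
  | |- rec_in _ (fun x => nat_of_bool (match _ with _ => _ end)) => apply rec_in_if_bool
  | |- rec_in _ (fun x => match _ with _ => _ end) => apply rec_in_if
  end.

Lemma rec_in_find A n (P : nat -> nat -> bool) : rec_in A n ->
  rec_in A (fun z => P (snd' z) (fst' z)) ->
  rec_in A (fun x => find (P x) (iota 0 (n x))).
Proof.
(* At counter [i] the accumulator is below [i] exactly if a hit has already been found. *)
move=> Hn HP; apply: (@rec_in_ext _ (fun x => iteri (n x)
  (fun i r => if r < i then r else if P x i then i else i.+1) 0)).
  move=> x; elim: (n x) => // k IH.
  rewrite -[in RHS]addn1 iotaD find_cat has_find size_iota [LHS]/= IH /=.
  by case: ltnP => // _; rewrite !add0n; case: (P x k); rewrite ?addn0 ?addn1.
solve_rec; have := rec_in_comp HP (g := fun z => pair (fst' z) (snd' (snd' z))).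
move/(_ ltac:(solve_rec)); apply: rec_in_ext => z; by rewrite !pairE.
Qed.

Lemma rec_in_has A n (P : nat -> nat -> bool) : rec_in A n ->
  rec_in A (fun z => P (snd' z) (fst' z)) ->
  rec_in A (fun x => has (P x) (iota 0 (n x))).
Proof.
move=> Hn HP; apply: (@rec_in_ext _ (fun x => find (P x) (iota 0 (n x)) < n x)).
  by move=> x; rewrite has_find size_iota.
by solve_rec; apply: rec_in_find.
Qed.

Lemma rec_in_all A n (P : nat -> nat -> bool) : rec_in A n ->
  rec_in A (fun z => P (snd' z) (fst' z)) ->
  rec_in A (fun x => all (P x) (iota 0 (n x))).
Proof.
move=> Hn HP; apply: (@rec_in_ext _ (fun x => ~~ has (fun i => ~~ P x i) (iota 0 (n x)))).
  by move=> x; rewrite -all_predC; congr nat_of_bool; apply: eq_all => i /=; rewrite negbK.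
by solve_rec; apply: rec_in_has; solve_rec.
Qed.

(** Lists as numbers: [0] is the empty list, and the successor keeps every cons nonzero. *)
Definition lcons a l := (pair a l).+1.
Definition lhd l := fst' l.-1.
Definition ltl l := snd' l.-1.

Lemma lhd_cons a l : lhd (lcons a l) = a. Proof. exact: fst_pair. Qed.
Lemma ltl_cons a l : ltl (lcons a l) = l. Proof. exact: snd_pair. Qed.
Definition lconsE := (lhd_cons, ltl_cons).

Definition chi (A : nat -> Prop) x : nat :=
  if excluded_middle_informative (A x) then 1 else 0.

Lemma chiP (A : nat -> Prop) x : chi A x != 0 <-> A x.
Proof. by rewrite /chi; case: excluded_middle_informative. Qed.

Lemma rec_in_chi A f : rec_in A f -> rec_in A (fun x => chi A (f x)).
Proof.
apply: rec_in_comp; exists COracle => x.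
by rewrite /chi; case: excluded_middle_informative => H; constructor.
Qed.

(** * Sets c.e. in an oracle *)

Definition ce (A S : nat -> Prop) : Prop :=
  exists c, forall x, S x <-> exists y, eval A c x y.

Lemma ce_ext A S S' : (forall x, S x <-> S' x) -> ce A S -> ce A S'.
Proof. by move=> E [c H]; exists c => x; rewrite -E. Qed.

Lemma ce_comp A S f : ce A S -> rec_in A f -> ce A (fun x => S (f x)).
Proof.
case=> c Hc [d Hd]; exists (CComp c d) => x; rewrite Hc; split=> -[y H].
  by exists y; apply: evComp (Hd x) H.
by case/eval_inv: H => z E1 E2; exists y; rewrite (eval_det (Hd x) E1).
Qed.

Lemma ce_exists A (P : nat -> nat -> bool) :
  rec_in A (fun z => P (fst' z) (snd' z)) -> ce A (fun x => exists n, P n x).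
Proof.
move=> H; have [c Hc] : rec_in A (fun z => ~~ P (fst' z) (snd' z)) by solve_rec.
have {}Hc n x : eval A c (pair n x) (~~ P n x) by have := Hc (pair n x); rewrite !pairE.
exists (CMu c) => x; split=> [exP | [n E]].
  case: (ex_minnP exP) => n Pn min_n; exists n; apply: evMu.
    by have := Hc n x; rewrite Pn.
  move=> m lt_mn; exists 0; have := Hc m x; case: (boolP (P m x)) => //.
  by move/min_n; rewrite leqNgt lt_mn.
exists n; case/eval_inv: E => Z1 _.
by have := eval_det (Hc n x) Z1; case: (P n x).
Qed.

(** * A stack machine for codes *)

Definition lenc (l : seq nat) : nat := foldr lcons 0 l.

Lemma iter_ltl_lenc i l : iter i ltl (lenc l) = lenc (drop i l).
Proof.
elim: i l => [|i IH] l; first by rewrite drop0.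
rewrite iterSr; case: l => [|a l] /=; last by rewrite ltl_cons IH.
by rewrite (IH [::]).
Qed.

Definition seg (w : nat -> nat) n := lenc (mkseq w n).

Lemma seg_lookup w n i : i < n -> 
  iter i ltl (seg w n) != 0 /\ lhd (iter i ltl (seg w n)) = w i.
Proof.
move=> lt_in; rewrite iter_ltl_lenc (drop_nth 0) ?size_mkseq //= lhd_cons.
by rewrite nth_mkseq.
Qed.

Lemma seg_end w n i : iter i ltl (seg w n) != 0 -> i < n.
Proof.
by rewrite iter_ltl_lenc ltnNge; apply: contra => le; rewrite drop_oversize ?size_mkseq.
Qed.

Lemma rec_in_lcons A f g : rec_in A f -> rec_in A g -> rec_in A (fun x => lcons (f x) (g x)).
Proof. by move=> Hf Hg; rewrite /lcons; solve_rec. Qed.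
Lemma rec_in_lhd A f : rec_in A f -> rec_in A (fun x => lhd (f x)).
Proof. by move=> Hf; rewrite /lhd; solve_rec. Qed.
Lemma rec_in_ltl A f : rec_in A f -> rec_in A (fun x => ltl (f x)).
Proof. by move=> Hf; rewrite /ltl; solve_rec. Qed.

Ltac rec_user ::=
  lazymatch goal with
  | |- rec_in _ (fun x => find (@?P x) (iota 0 (@?n x))) => apply (@rec_in_find _ n P)
  | |- rec_in _ (fun x => nat_of_bool (has (@?P x) (iota 0 (@?n x)))) =>
      apply (@rec_in_has _ n P)
  | |- rec_in _ (fun x => nat_of_bool (all (@?P x) (iota 0 (@?n x)))) =>
      apply (@rec_in_all _ n P)
  | |- rec_in _ (fun x => lcons (@?f x) (@?g x)) => apply (@rec_in_lcons _ f g)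
  | |- rec_in _ (fun x => lhd (@?f x)) => apply (@rec_in_lhd _ f)
  | |- rec_in _ (fun x => ltl (@?f x)) => apply (@rec_in_ltl _ f)
  | |- rec_in _ ltl => apply (rec_in_ltl (rec_in_id _))
  | |- rec_in _ (fun x => chi ?A (@?f x)) => apply (@rec_in_chi A f)
  end.

Lemma rec_in_seg A w f : rec_in A w -> rec_in A f -> rec_in A (fun x => seg w (f x)).
Proof.
move=> Hw Hf.
apply: (@rec_in_ext _ (fun x => iteri (f x) (fun j r => lcons (w (f x - j.+1)) r) 0)).
  move=> x; move: (f x) => n.
  suff H j : j <= n -> iteri j (fun j r => lcons (w (n - j.+1)) r) 0 =
                       lenc (drop (n - j) (mkseq w n)).
    by rewrite H // subnn drop0.
  elim: j => [|j IH] lt_jn; first by rewrite subn0 drop_oversize ?size_mkseq.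
  rewrite /= IH 1?ltnW // [in RHS](drop_nth 0) ?size_mkseq; last lia.
  by rewrite nth_mkseq ?subnSK //; lia.
by solve_rec.
Qed.

(** A second numbering, which the machine can take apart with [fst'] and [snd']; [dec] below
    translates Goedel numbers into it. *)
Fixpoint rep (c : code) : nat :=
  match c with
  | CZero => pair 0 0
  | CSucc => pair 1 0
  | CId => pair 2 0
  | CFst => pair 3 0
  | CSnd => pair 4 0
  | COracle => pair 5 0
  | CPair f g => pair 6 (pair (rep f) (rep g))
  | CComp f g => pair 7 (pair (rep f) (rep g))
  | CPrim f g => pair 8 (pair (rep f) (rep g))
  | CMu f => pair 9 (rep f)
  end.

(* A machine state [pair k v] consists of a stack [k] of instructions and a   *)
(* current value [v]. An instruction is either a code to be run on [v] (tags  *)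
(* 0-9) or a frame waiting for the value [v] of a subcomputation: 10 and 11   *)
(* for the two components of CPair, 12 and 13 for the loops of CPrim and CMu. *)
(* The list [s] stands for a finite part of the oracle; a query outside of it *)
(* makes the machine loop. *)
Definition exec s k t a v :=
  if t == 0 then pair k 0
  else if t == 1 then pair k v.+1
  else if t == 2 then pair k v
  else if t == 3 then pair k (fst' v)
  else if t == 4 then pair k (snd' v)
  else if t == 5 then
    if iter v ltl s == 0 then pair (lcons (pair 5 0) k) v
    else pair k (lhd (iter v ltl s) != 0)
  else if t == 6 then
    pair (lcons (fst' a) (lcons (pair 10 (pair (snd' a) v)) k)) v
  else if t == 7 then pair (lcons (snd' a) (lcons (fst' a) k)) v
  else if t == 8 then
    pair (lcons (fst' a) (lcons (pair 12 (pair (snd' a) (pair 0 v))) k)) (snd' v)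
  else if t == 9 then
    pair (lcons a (lcons (pair 13 (pair a (pair 0 v))) k)) (pair 0 v)
  else if t == 10 then pair (lcons (fst' a) (lcons (pair 11 v) k)) (snd' a)
  else if t == 11 then pair k (pair a v)
  else if t == 12 then
    if fst' (snd' a) == fst' (snd' (snd' a)) then pair k v
    else pair (lcons (fst' a)
                (lcons (pair 12 (pair (fst' a)
                          (pair (fst' (snd' a)).+1 (snd' (snd' a))))) k))
              (pair (fst' (snd' a)) (pair v (snd' (snd' (snd' a)))))
  else
    if v == 0 then pair k (fst' (snd' a))
    else pair (lcons (fst' a)
                (lcons (pair 13 (pair (fst' a)
                          (pair (fst' (snd' a)).+1 (snd' (snd' a))))) k))
              (pair (fst' (snd' a)).+1 (snd' (snd' a))).

Definition mstep s st :=
  if fst' st == 0 then st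
  else exec s (ltl (fst' st)) (fst' (lhd (fst' st))) (snd' (lhd (fst' st))) (snd' st).

Definition halts s n st : bool := fst' (iter n (mstep s) st) == 0.

Lemma rec_in_exec A s k t a v :
  rec_in A s -> rec_in A k -> rec_in A t -> rec_in A a -> rec_in A v ->
  rec_in A (fun x => exec (s x) (k x) (t x) (a x) (v x)).
Proof. by move=> Hs Hk Ht Ha Hv; rewrite /exec; solve_rec. Qed.

Lemma rec_in_mstep A s st : rec_in A s -> rec_in A st ->
  rec_in A (fun x => mstep (s x) (st x)).
Proof. by move=> Hs Hst; rewrite /mstep; solve_rec; apply: rec_in_exec; solve_rec. Qed.

Lemma rec_in_halts A s n st : rec_in A s -> rec_in A n -> rec_in A st ->
  rec_in A (fun x => halts (s x) (n x) (st x)).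
Proof.
by move=> Hs Hn Hst; rewrite /halts; solve_rec; apply: rec_in_mstep; solve_rec.
Qed.

Lemma mstepE s t a k v : mstep s (pair (lcons (pair t a) k) v) = exec s k t a v.
Proof. by rewrite /mstep fst_pair snd_pair lhd_cons ltl_cons !pairE; case: (exec s k t a v). Qed.

(** Only the entries present in [s] are constrained, and any nonzero entry counts as membership;
    this lets entries carry a stage in [W_jump]. *)
Definition agrees s (B : nat -> Prop) :=
  forall i, iter i ltl s != 0 -> (lhd (iter i ltl s) != 0 <-> B i).

Lemma agrees_seg B n : agrees (seg (chi B) n) B.
Proof. by move=> i /seg_end/(seg_lookup (chi B))[_ ->]; apply: chiP. Qed.

(** The use principle is built in: the one bound [N] covers all oracle queries on the way, whichever
    finite oracle is supplied. *)
Definition reach B st st' := exists N, forall s, agrees s B ->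
  (forall i, i < N -> iter i ltl s != 0) -> exists n, iter n (mstep s) st = st'.

Lemma reach_refl B st : reach B st st.
Proof. by exists 0 => s _ _; exists 0. Qed.

Lemma reach_trans B a b c : reach B a b -> reach B b c -> reach B a c.
Proof.
move=> [N1 H1] [N2 H2]; exists (maxn N1 N2) => s As len_s.
have [|n1 E1] := H1 s As; first by move=> i lt; apply: len_s; rewrite leq_max lt.
have [|n2 E2] := H2 s As; first by move=> i lt; apply: len_s; rewrite leq_max lt orbT.
by exists (n2 + n1); rewrite iterD E1.
Qed.

Lemma reach_step B t a k v st' : 
  (exists N, forall s, agrees s B -> (forall i, i < N -> iter i ltl s != 0) ->
     exec s k t a v = st') -> reach B (pair (lcons (pair t a) k) v) st'.
Proof.
by move=> [N H]; exists N => s As len_s; exists 1; rewrite /= mstepE; exact: H.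
Qed.

Ltac rstep := apply: reach_trans;
  [apply: reach_step; exists 0 => s _ _; rewrite /exec /= ?pairE; reflexivity|].

(** Keeping the stack [k] arbitrary lets the induction hypotheses apply above the frames of the
    enclosing computation. *)
Lemma reach_eval B c x y k : eval B c x y -> reach B (pair (lcons (rep c) k) x) (pair k y).
Proof.
elim: c x y k => [|||||| f IHf g IHg | f IHf g IHg | f IHf g IHg | f IHf] x y k /eval_inv.
1-5: by move=> ->; rstep; exact: reach_refl.
- move=> H; apply: reach_step; exists x.+1 => s As /(_ x (ltnSn _)) ne0.
  rewrite /exec /= (negPf ne0); have := As x ne0.
  by case: H => -[Bx ->] iffB; congr pair; case: eqP iffB => //= _ [H1 H2]; exfalso; intuition.
- by move=> [a [b [Ha Hb ->]]]; rstep; apply: reach_trans (IHf _ _ _ Ha) _; rstep;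
    apply: reach_trans (IHg _ _ _ Hb) _; rstep; exact: reach_refl.
- by move=> [a Ha Hb]; rstep; apply: reach_trans (IHg _ _ _ Ha) _; exact: IHf.
- move=> /= H; rstep.
  have {H} E : eval B (CPrim f g) x y.
    rewrite -(pair_surj x); case: (fst' x) H => [|n]; first by constructor.
    by move=> [r Hr Hz]; apply: evPrimS Hr Hz.
  rewrite -{1}(pair_surj x) in E.
  have H i z : i <= fst' x -> eval B (CPrim f g) (pair i (snd' x)) z ->
    reach B (pair (lcons (rep f) (lcons (pair 12 (pair (rep g) (pair 0 x))) k)) (snd' x))
            (pair (lcons (pair 12 (pair (rep g) (pair i x))) k) z).
    elim: i z => [|i IHi] z le /eval_inv; rewrite !pairE; first exact: IHf.
    move=> [r Hr Hy]; apply: reach_trans (IHi _ (ltnW le) Hr) _.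
    apply: reach_trans.
      apply: reach_step; exists 0 => s _ _; rewrite /exec /= !pairE ifF; first by reflexivity.
      by apply/negbTE; rewrite neq_ltn le.
    exact: IHg.
  apply: reach_trans (H _ _ (leqnn _) E) _; rstep; rewrite eqxx; exact: reach_refl.
- move=> [H0 Hpos]; rstep.
  suff H i : i <= y -> reach B
      (pair (lcons (rep f) (lcons (pair 13 (pair (rep f) (pair 0 x))) k)) (pair 0 x))
      (pair (lcons (rep f) (lcons (pair 13 (pair (rep f) (pair i x))) k)) (pair i x)).
    apply: reach_trans (H _ (leqnn _)) _; apply: reach_trans (IHf _ _ _ H0) _.
    by rstep; exact: reach_refl.
  elim: i => [|i IHi] le; first exact: reach_refl.
  apply: reach_trans (IHi (ltnW le)) _; have [r Hr] := Hpos _ le.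
  by apply: reach_trans (IHf _ _ _ Hr) _; rstep; exact: reach_refl.
Qed.

Lemma halts_step s n t a k v : halts s n (pair (lcons (pair t a) k) v) ->
  exists2 m, n = m.+1 & halts s m (exec s k t a v).
Proof.
case: n => [|n]; first by rewrite /halts /= pairE.
by rewrite /halts iterSr mstepE; exists n.
Qed.

(** Strong induction on the number of steps: to empty the stack the machine must first return to
    [k], and each subcomputation leaves strictly fewer steps. *)
Lemma halts_eval B s : agrees s B -> forall n c k x,
  halts s n (pair (lcons (rep c) k) x) ->
  exists y m, [/\ m < n, eval B c x y & halts s m (pair k y)].
Proof.
move=> As; elim/ltn_ind => n IH.
case=> [|||||| f g | f g | f g | f] k x /=.
all: case/halts_step => m nE; rewrite /exec /= ?pairE => Hm; rewrite {}nE in IH *.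
1-5: by eexists; exists m; split=> //; [constructor | ].
(* A query beyond the end of [s] repeats the same state with fewer steps left, so the induction
   hypothesis applies again. *)
- case: ifP Hm => [_|/negbT ne0] Hm.
    have [y [m' [lt E h]]] := IH m (ltnSn _) COracle k x Hm.
    by exists y, m'; split => //; apply: ltnW.
  exists (lhd (iter x ltl s) != 0), m; split=> //; have := As x ne0.
  by case: (lhd _ != 0) => -[H1 H2]; constructor; [exact: H1 | move/H2].
- have [a [m1 [lt1 Ea]]] := IH m (ltnSn _) _ _ _ Hm.
  case/halts_step => m2 E2; rewrite /exec /= !pairE => Hm2.
  have [|b [m3 [lt3 Eb]]] := IH m2 _ _ _ _ Hm2; first lia.
  case/halts_step => m4 E4; rewrite /exec /= => Hm4.
  by exists (pair a b), m4; split => //; [lia | constructor].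
- have [a [m1 [lt1 Ea Hm1]]] := IH m (ltnSn _) _ _ _ Hm.
  have [|b [m3 [lt3 Eb Hb]]] := IH m1 _ _ _ _ Hm1; first lia.
  by exists b, m3; split => //; [lia | econstructor; eauto].
- have [a [m1 [lt1 Ea Hm1]]] := IH m (ltnSn _) _ _ _ Hm.
  have {}Ea : eval B (CPrim f g) (pair 0 (snd' x)) a by constructor.
  suff loop p i r : halts s p (pair (lcons (pair 12 (pair (rep g) (pair i x))) k) r) ->
      p < m.+1 -> i <= fst' x -> eval B (CPrim f g) (pair i (snd' x)) r ->
      exists y q, [/\ q < m.+1, eval B (CPrim f g) x y & halts s q (pair k y)].
    by apply: loop Hm1 _ _ Ea => //; lia.
  elim/ltn_ind: p i r => p IHm i r {}Hm1 {}lt1 le Er.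
  case/halts_step: Hm1 => m2 E2; rewrite /exec /= !pairE; case: eqP => [Ei|ne] Hm2.
    by exists r, m2; split => //; [lia | rewrite -(pair_surj x) -Ei].
  have [|b [m3 [lt3 Eb Hm3]]] := IH m2 _ _ _ _ Hm2; first lia.
  by apply: (IHm m3 _ i.+1 b) => //; try lia; apply: evPrimS Er Eb.
- have [a [m1 [lt1 Ea Hm1]]] := IH m (ltnSn _) _ _ _ Hm.
  suff loop p i r : eval B f (pair i x) r ->
      halts s p (pair (lcons (pair 13 (pair (rep f) (pair i x))) k) r) ->
      p < m.+1 -> (forall j, j < i -> exists z, eval B f (pair j x) z.+1) ->
      exists y q, [/\ q < m.+1, eval B (CMu f) x y & halts s q (pair k y)].
    by apply: loop Ea Hm1 _ _ => //; lia.
  elim/ltn_ind: p i r => p IHm i r Er {}Hm1 {}lt1 Hi.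
  case/halts_step: Hm1 => m2 E2; rewrite /exec /= !pairE; case: eqP => [r0|ne] Hm2.
    by exists i, m2; split => //; [lia | subst r; constructor].
  have [|b [m3 [lt3 Eb Hm3]]] := IH m2 _ _ _ _ Hm2; first lia.
  apply: (IHm m3 _ i.+1 b) => //; try lia.
  move=> j; rewrite ltnS leq_eqVlt => /orP[/eqP->|]; last exact: Hi.
  by exists r.-1; rewrite prednK //; lia.
Qed.

Lemma halts_complete B c x : (exists y, eval B c x y) -> exists N, forall s, agrees s B ->
  (forall i, i < N -> iter i ltl s != 0) -> exists n, halts s n (pair (lcons (rep c) 0) x).
Proof.
move=> [y /(reach_eval 0)[N H]]; exists N => s As len_s.
by have [n E] := H s As len_s; exists n; rewrite /halts E pairE.
Qed.

Lemma halts_sound B s n c x : agrees s B ->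
  halts s n (pair (lcons (rep c) 0) x) -> exists y, eval B c x y.
Proof. by move=> As /(halts_eval As)[y [_ [_ E _]]]; exists y. Qed.

(** * Decoding of program indices *)

(** This is the cons of [CodeSeq.code], the sequence encoding beneath [pickle]. *)
Definition bcons a m := 2 ^ a * m.*2.+1.

Lemma bconsE a m : bcons a m = CodeSeq.code (a :: CodeSeq.decode m).
Proof. by rewrite /= CodeSeq.decodeK. Qed.

Lemma decode_bcons a m : CodeSeq.decode (bcons a m) = a :: CodeSeq.decode m.
Proof. by rewrite bconsE CodeSeq.codeK. Qed.

Lemma bcons_inj a m b n : bcons a m = bcons b n -> a = b /\ m = n.
Proof.
move/(congr1 CodeSeq.decode); rewrite !decode_bcons => -[-> E]; split=> //.
by rewrite -(CodeSeq.decodeK m) E CodeSeq.decodeK.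
Qed.

Lemma ltn_bconsl a m : a < bcons a m.
Proof. by rewrite bconsE; case/andP: (CodeSeq.ltn_code (a :: CodeSeq.decode m)). Qed.

Lemma ltn_bconsr a m : m < bcons a m.
Proof.
rewrite /bcons; have : 0 < 2 ^ a by rewrite expn_gt0.
by case: (2 ^ a) => // k _; nia.
Qed.

Variant bcons_spec : nat -> Prop :=
| BNil : bcons_spec 0
| BCons a m : bcons_spec (bcons a m).

Lemma bconsP n : bcons_spec n.
Proof.
rewrite -(CodeSeq.decodeK n); case: (CodeSeq.decode n) => [|a l]; first by left.
by right.
Qed.

Lemma find_iota_unique (P : pred nat) n a : a < n -> P a -> (forall b, P b -> b = a) ->
  find P (iota 0 n) = a.
Proof.
move=> lt_an Pa uniqP.
have hasP : has P (iota 0 n) by apply/hasP; exists a; rewrite ?mem_iota.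
have := nth_find 0 hasP; rewrite nth_iota; first by move/uniqP.
by rewrite has_find size_iota in hasP.
Qed.

(** Head and tail are both smaller than [bcons a m], so bounded search finds them. *)
Definition bhd n := find (fun a => has (fun m => n == bcons a m) (iota 0 n)) (iota 0 n).
Definition btl n := find (fun m => has (fun a => n == bcons a m) (iota 0 n)) (iota 0 n).

Lemma bhd_cons a m : bhd (bcons a m) = a.
Proof.
apply: find_iota_unique => [|| b /hasP[k _ /eqP/bcons_inj[]]] //; first exact: ltn_bconsl.
by apply/hasP; exists m; rewrite ?mem_iota ?add0n ?ltn_bconsr ?eqxx.
Qed.

Lemma btl_cons a m : btl (bcons a m) = m.
Proof.
apply: find_iota_unique => [|| b /hasP[k _ /eqP/bcons_inj[]]] //; first exact: ltn_bconsr.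
by apply/hasP; exists a; rewrite ?mem_iota ?add0n ?ltn_bconsl ?eqxx.
Qed.

Lemma rec_in_bcons A f g : rec_in A f -> rec_in A g -> rec_in A (fun x => bcons (f x) (g x)).
Proof.
move=> Hf Hg; rewrite /bcons; apply: (@rec_in_ext _ (fun x => 2 ^ f x * (2 * g x).+1)).
  by move=> x; rewrite mul2n.
by solve_rec.
Qed.

Lemma rec_in_bhd A f : rec_in A f -> rec_in A (fun x => bhd (f x)).
Proof. by move=> Hf; rewrite /bhd; solve_rec; apply: rec_in_bcons; solve_rec. Qed.

Lemma rec_in_btl A f : rec_in A f -> rec_in A (fun x => btl (f x)).
Proof. by move=> Hf; rewrite /btl; solve_rec; apply: rec_in_bcons; solve_rec. Qed.

(* The list of suffixes of [CodeSeq.decode n] is traversed from the end, which *)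
(* turns the right fold into a primitive recursion. *)
Definition bfold (F : nat -> nat -> nat) b n :=
  iteri n (fun k r => if iter (n - k.+1) btl n == 0 then r
                      else F (bhd (iter (n - k.+1) btl n)) r) b.

Lemma bfoldE F b n : bfold F b n = foldr F b (CodeSeq.decode n).
Proof.
have btl0 : btl 0 = 0 by [].
have end0 : iter n btl n = 0.
  elim/ltn_ind: n => n; case: (bconsP n) => // a m IH.
  case E : (bcons a m) (ltn_bconsr a m) => [//|j] lt; rewrite ltnS in lt.
  rewrite iterSr -E btl_cons -(subnK lt) iterD IH ?E //.
  by elim: (j - m) => //= i ->.
suff H k : k <= n -> iteri k (fun k r => if iter (n - k.+1) btl n == 0 then r
              else F (bhd (iter (n - k.+1) btl n)) r) b =
   foldr F b (CodeSeq.decode (iter (n - k) btl n)).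
  by rewrite /bfold H // subnn.
elim: k => [|k IH] le; first by rewrite subn0 end0.
rewrite /= IH 1?ltnW // -(subnSK le) iterS.
case: (bconsP (iter (n - k.+1) btl n)) => [|a m]; first by rewrite btl0.
by rewrite btl_cons bhd_cons decode_bcons /= ifF //; have := ltn_bconsl a m; case: bcons.
Qed.

Lemma rec_in_bfold A (F : nat -> nat -> nat) b f :
  rec_in A (fun z => F (fst' z) (snd' z)) -> rec_in A f ->
  rec_in A (fun x => bfold F b (f x)).
Proof.
move=> HF Hf; rewrite /bfold; solve_rec; try by apply: rec_in_btl; solve_rec.
pose g z := pair (bhd (iter (f (snd' (snd' z)) - (fst' z).+1) btl (f (snd' (snd' z)))))
                 (fst' (snd' z)).
apply: (@rec_in_ext _ (fun z => F (fst' (g z)) (snd' (g z)))); first by move=> z; rewrite !pairE.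
apply: (rec_in_comp HF); rewrite /g; solve_rec.
by apply: rec_in_bhd; solve_rec; apply: rec_in_btl; solve_rec.
Qed.

(* 0 stands for [None] and [n.+1] for the code represented by [n]. *)
Definition orep (c : option code) : nat := if c is Some c then (rep c).+1 else 0.

(** [tree_to_code] at a node with label [n], given the list of the values of its children. As
    [lhd 0 = 0], the test [lhd l != 0] checks both that a child exists and that it decodes. *)
Definition node n l : nat :=
  if n <= 5 then (if l == 0 then (pair n 0).+1 else 0)
  else if n <= 8 then
    if [&& lhd l != 0, lhd (ltl l) != 0 & ltl (ltl l) == 0]
    then (pair n (pair (lhd l).-1 (lhd (ltl l)).-1)).+1 else 0
  else if [&& n == 9, lhd l != 0 & ltl l == 0] then (pair 9 (lhd l).-1).+1 else 0.

Definition trep (t : GenTree.tree nat) := orep (tree_to_code t).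

Lemma lhd0 : lhd 0 = 0. Proof. by rewrite /lhd -(fst_pair 0 0). Qed.
Lemma ltl0 : ltl 0 = 0. Proof. by rewrite /ltl -(snd_pair 0 0). Qed.

Lemma nodeE n ts : trep (GenTree.Node n ts) = node n (lenc (map trep ts)).
Proof.
rewrite [LHS]/trep.
do 6 (case: n => [|n]; first by case: ts).
have bin (F : code -> code -> code) k : 5 < k <= 8 ->
   (forall f g, rep (F f g) = pair k (pair (rep f) (rep g))) ->
   orep match ts with
        | [:: t1; t2] => match tree_to_code t1, tree_to_code t2 with
                         | Some f, Some g => Some (F f g) | _, _ => None end
        | _ => None end = node k (lenc (map trep ts)).
  rewrite /node => /andP[k5 k8] E; rewrite leqNgt k5 k8 /=.
  case: ts => [|t1 [|t2 [|t3 ts]]] //=; rewrite ?lconsE ?lhd0 ?ltl0 ?eqxx ?andbF //=.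
  rewrite /trep; case: (tree_to_code t1) => // f; case: (tree_to_code t2) => //= g.
  by rewrite E.
case: n => [|n]; first by rewrite -(bin CPair).
case: n => [|n]; first by rewrite -(bin CComp).
case: n => [|n]; first by rewrite -(bin CPrim).
rewrite /node {bin}; case: n => [|n] //=.
case: ts => [|t1 [|t2 ts]] //=; rewrite ?lconsE ?lhd0 ?ltl0 ?eqxx ?andbF //=.
by rewrite /trep; case: (tree_to_code t1).
Qed.

Lemma rec_in_node A f g : rec_in A f -> rec_in A g -> rec_in A (fun x => node (f x) (g x)).
Proof. by move=> Hf Hg; rewrite /node; solve_rec. Qed.

Definition strep (fs : seq (GenTree.tree nat) * seq (seq (GenTree.tree nat))) : nat :=
  pair (lenc (map trep fs.1)) (lenc (map (fun l => lenc (map trep l)) fs.2)).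

(* A token is [CodeSeq.code [:: x; y]], with [y != 0] for leaves, and         *)
(* [y = 0] and [x = bcons n _] for [inl n]; unpickle skips all other numbers.  *)
Definition dstep t r : nat :=
  if [&& t != 0, btl t != 0 & btl (btl t) == 0] then
    if bhd (btl t) != 0 then pair (lcons 0 (fst' r)) (snd' r)
    else if bhd t == 0 then r
    else if bhd (bhd t) == 0 then pair 0 (lcons (fst' r) (snd' r))
    else pair (lcons (node (bhd (bhd t)).-1 (fst' r)) (lhd (snd' r))) (ltl (snd' r))
  else r.

Lemma rec_in_dstep A f g : rec_in A f -> rec_in A g -> rec_in A (fun x => dstep (f x) (g x)).
Proof.
move=> Hf Hg; rewrite /dstep; solve_rec;
  repeat first [apply: rec_in_bhd | apply: rec_in_btl | apply: rec_in_node | progress solve_rec].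
Qed.

Lemma unpickle_opt n : unpickle n = Some (ohead (CodeSeq.decode n)) :> option (option nat).
Proof.
transitivity (Some (ohead (pmap (@Some nat) (CodeSeq.decode n)))); first by [].
by case: (CodeSeq.decode n).
Qed.

Lemma unpickle_token (t : nat) :
  unpickle t = (if CodeSeq.decode t is [:: x; y] then
    if CodeSeq.decode y is z :: _ then Some (inr z)
    else if CodeSeq.decode x is z :: _ then Some (inl z) else None else None) :> option (nat + nat).
Proof.
transitivity (obind sum_of_opair (obind (fun u => Some (pair_of_tag u))
   (@unpickle_tagged (option nat) (fun _ => option nat) t))); first by [].
rewrite /unpickle_tagged; case: (CodeSeq.decode t) => [|x [|y []]] //.
by rewrite !unpickle_opt; case: (CodeSeq.decode x) => [|? ?]; case: (CodeSeq.decode y).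
Qed.

Lemma unpickle_codeE e : unpickle e = obind tree_to_code
  (GenTree.decode (pmap (@unpickle (nat + nat)%type) (CodeSeq.decode e))) :> option code.
Proof. by []. Qed.

Lemma dstepE t fs : dstep t (strep fs) =
  strep (if unpickle t is Some c then GenTree.decode_step c fs else fs).
Proof.
rewrite unpickle_token /dstep; case: (bconsP t) => // x m.
rewrite decode_bcons btl_cons bhd_cons.
rewrite (_ : bcons x m != 0); last by have := ltn_bconsl x m; case: bcons.
case: (bconsP m) => // y m'.
rewrite decode_bcons btl_cons bhd_cons.
rewrite (_ : bcons y m' != 0); last by have := ltn_bconsl y m'; case: bcons.
case: (bconsP m') => [|z m'']; last first.
  rewrite decode_bcons (_ : (bcons z m'' == 0) = false) //.
  by have := ltn_bconsl z m''; case: bcons.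
rewrite /= /strep; case: (bconsP y) => [|z l]; last first.
  rewrite decode_bcons (_ : bcons z l != 0) ?pairE //.
  by have := ltn_bconsl z l; case: bcons.
rewrite /=; case: (bconsP x) => [|z l] //.
rewrite decode_bcons bhd_cons (_ : (bcons z l == 0) = false); last first.
  by have := ltn_bconsl z l; case: bcons.
rewrite /= !pairE; case: z => [|n] //=; rewrite nodeE.
by case: fs => l1 [|l2 ls] /=; rewrite ?lconsE ?lhd0 ?ltl0.
Qed.

(** The initial [0] is the empty state, since [pair 0 0 = 0]. The final predecessor sends failure to
    [0], which is [rep CZero], the default of [prog]. *)
Definition dec e := (lhd (fst' (bfold dstep 0 e))).-1.

Lemma pair00 : pair 0 0 = 0.
Proof. by []. Qed.

Lemma decE e : dec e = rep (prog e).
Proof.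
rewrite /dec /prog unpickle_codeE bfoldE /GenTree.decode; set fs0 := ([::], [::]).
have -> : foldr dstep 0 (CodeSeq.decode e) =
  strep (foldr (@GenTree.decode_step nat) fs0
           (pmap (@unpickle (nat + nat)%type) (CodeSeq.decode e))).
  elim: (CodeSeq.decode e) => [|t l IH] /=; first by rewrite /strep /= pair00.
  by rewrite IH dstepE; case: (unpickle t).
rewrite /strep pairE; case: (foldr _ _ _).1 => [|t ts] /=; first by rewrite lhd0 pair00.
by rewrite lhd_cons /trep; case: (tree_to_code t) => //=; rewrite pair00.
Qed.

Lemma rec_in_dec A f : rec_in A f -> rec_in A (fun x => dec (f x)).
Proof.
move=> Hf; rewrite /dec; solve_rec; apply: rec_in_bfold => //.
by apply: rec_in_dstep; solve_rec.
Qed.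

(** * The s-m-n theorem *)

Definition put (l : seq nat) m := foldr bcons m l.

Lemma rec_in_put A l f : rec_in A f -> rec_in A (fun x => put l (f x)).
Proof. by move=> Hf; elim: l => //= a l IH; apply: rec_in_bcons => //; solve_rec. Qed.

Definition tokens (c : code) : seq nat :=
  map (@pickle (nat + nat)%type) (GenTree.encode (code_to_tree c)).

Lemma pickle_code c : pickle c = put (tokens c) 0.
Proof. by []. Qed.

Definition op_tok n : nat := pickle (inl n.+1 : nat + nat).
Definition end_tok : nat := pickle (inl 0 : nat + nat).

Lemma put_comp f g m : put (tokens (CComp f g)) m =
  bcons (op_tok 7) (put (tokens f) (put (tokens g) (bcons end_tok m))).
Proof. by rewrite /put /tokens /= cats0 map_rcons map_cat -cats1 !foldr_cat. Qed.

Lemma put_pair f g m : put (tokens (CPair f g)) m =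
  bcons (op_tok 6) (put (tokens f) (put (tokens g) (bcons end_tok m))).
Proof. by rewrite /put /tokens /= cats0 map_rcons map_cat -cats1 !foldr_cat. Qed.

#[local] Opaque bcons op_tok end_tok tokens put.

Fixpoint cst n : code := if n is m.+1 then CComp CSucc (cst m) else CZero.

Lemma eval_cst A n x : eval A (cst n) x n.
Proof. by elim: n => [|n IH] /=; econstructor; eauto; constructor. Qed.

(** The nested compositions in [cst n] give [n] opening blocks, one zero and [n] closing tokens,
    hence two iterations around a fixed middle. *)
Lemma put_cst n m : put (tokens (cst n)) m =
  iter n (fun r => bcons (op_tok 7) (put (tokens CSucc) r))
    (put (tokens CZero) (iter n (bcons end_tok) m)).
Proof.
elim: n m => [|n IH] m; first exact: erefl.
rewrite (put_comp CSucc (cst n)) (IH (bcons end_tok m)) {IH}.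
move: (op_tok 7) end_tok (tokens CSucc) (tokens CZero) => o e tS tZ.
by rewrite [iter n.+1 (bcons e) m]iterSr.
Qed.

Lemma rec_in_pickle_partial A c :
  rec_in A (fun i => pickle (CComp c (CPair (cst i) CId))).
Proof.
apply: (@rec_in_ext _ (fun i => bcons (op_tok 7) (put (tokens c) (bcons (op_tok 6)
   (iter i (fun r => bcons (op_tok 7) (put (tokens CSucc) r))
    (put (tokens CZero) (iter i (bcons end_tok)
       (put (tokens CId) (bcons end_tok (bcons end_tok 0)))))))))).
  by move=> i; rewrite pickle_code put_comp put_pair put_cst.
repeat first [apply: rec_in_bcons | apply: rec_in_put | progress solve_rec].
Qed.

Lemma prog_pickle c : prog (pickle c) = c.
Proof. by rewrite /prog pickleK. Qed.

Lemma smn A S : ce A S -> exists g, (forall B, rec_in B g) /\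
  forall i x, W A (g i) x <-> S (pair i x).
Proof.
case=> c Hc; exists (fun i => pickle (CComp c (CPair (cst i) CId))).
split=> [B|i x]; first exact: rec_in_pickle_partial.
rewrite /W prog_pickle Hc.
have E : eval A (CPair (cst i) CId) x (pair i x).
  by constructor; [exact: eval_cst | constructor].
split=> -[y H]; exists y; last by apply: evComp E H.
by case/eval_inv: H => z /(eval_det E) <-.
Qed.

(** The program with index [h i] ignores its input, so running it on its own index amounts to
    enumerating [i] into [S]. *)
Lemma jump_complete A S : ce A S -> exists h, (forall B, rec_in B h) /\
  forall i, jump A (h i) <-> S i.
Proof.
move=> ceS; have [|h [Hh hE]] := smn (A := A) (S := fun z => S (fst' z)).
  by apply: ce_comp ceS _; solve_rec.
by exists h; split=> // i; rewrite /jump hE pairE.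
Qed.

(** * Normal form and Post's theorem *)

Definition accepts n e x s : bool := halts s n (pair (lcons (dec e) 0) x).

Lemma rec_in_accepts A n e x s : rec_in A n -> rec_in A e -> rec_in A x -> rec_in A s ->
  rec_in A (fun z => accepts (n z) (e z) (x z) (s z)).
Proof.
move=> Hn He Hx Hs; rewrite /accepts; apply: rec_in_halts => //; solve_rec; exact: rec_in_dec.
Qed.

Lemma accepts_sound B n e x s : agrees s B -> accepts n e x s -> W B e x.
Proof. by move=> As; rewrite /accepts decE => /(halts_sound As). Qed.

Lemma accepts_complete B e x : W B e x -> exists N, forall s, agrees s B ->
  (forall i, i < N -> iter i ltl s != 0) -> exists n, accepts n e x s.
Proof. by rewrite /accepts decE; exact: halts_complete. Qed.

Definition run A m e x : bool := accepts (fst' m) e x (seg (chi A) (snd' m)).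

Lemma rec_in_run A m e x : rec_in A m -> rec_in A e -> rec_in A x ->
  rec_in A (fun z => run A (m z) (e z) (x z)).
Proof.
move=> Hm He Hx; apply: rec_in_accepts; solve_rec.
by apply: rec_in_seg; solve_rec; exact: (rec_in_chi (rec_in_id A)).
Qed.

Lemma W_run A e x : W A e x <-> exists m, run A m e x.
Proof.
split=> [/accepts_complete[N H] | [m]]; last exact/accepts_sound/agrees_seg.
have [|n Hn] := H _ (@agrees_seg A N).
  by move=> i /(seg_lookup (chi A))[].
by exists (pair n N); rewrite /run !pairE.
Qed.

Lemma ce_W A : ce A (fun z => W A (fst' z) (snd' z)).
Proof.
apply: (@ce_ext _ (fun z => exists m, run A m (fst' z) (snd' z))).
  by move=> z; rewrite W_run.
by apply: ce_exists; apply: rec_in_run; solve_rec.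
Qed.

(** By completeness of the jump, [S k x] is a single query to [jump A], so an unbounded search finds
    a [k] where it fails. *)
Lemma ce_jump A S : ce A (fun z => S (fst' z) (snd' z)) ->
  ce (jump A) (fun x => exists k, ~ S k x).
Proof.
case/jump_complete => h [Hh hE].
apply: (@ce_ext _ (fun x => exists k, chi (jump A) (h (pair k x)) == 0)).
  move=> x; split=> -[k Hk]; exists k.
    move=> Skx; have /chiP : jump A (h (pair k x)) by apply/hE; rewrite !pairE.
    by rewrite Hk.
  by apply/negPn/negP => /chiP/hE; rewrite !pairE.
by apply: ce_exists; solve_rec.
Qed.

(* The witness [k] codes a halting time and a finite oracle [s], in which the *)
(* entry [0] claims [i \notin jump A] and the entry [t.+1] claims that [i]    *)
(* enters [jump A] at stage [t]; refuting these claims is c.e. in [A]. *)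
Lemma W_jump A : exists q, (forall B, rec_in B q) /\ forall e x,
  W (jump A) e x <-> exists k, ~ jump A (q (pair (pair e x) k)).
Proof.
pose look i k := iter i ltl (snd' k).
(* The first component of [m] selects the entry to refute; the second is a stage at which [i] enters
   [jump A] against an entry [0]. *)
pose bad m z := let: k := snd' z in let: i := fst' m in
  ~~ accepts (fst' k) (fst' (fst' z)) (snd' (fst' z)) (snd' k) ||
  ((look i k != 0) &&
   (if lhd (look i k) == 0 then run A (snd' m) i i
    else ~~ run A (lhd (look i k)).-1 i i)).
have ce_bad : ce A (fun z => exists m, bad m z).
  apply: ce_exists; rewrite /bad /look; solve_rec; first by apply: rec_in_accepts; solve_rec.
    by apply: rec_in_run; solve_rec.
  by apply: rec_in_run; solve_rec.
have [q [Hq qE]] := jump_complete ce_bad; exists q; split=> // e x; split; last first.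
  move=> [k /qE nbad].
  have good m : ~~ bad m (pair (pair e x) k) by apply/negP => bm; apply: nbad; exists m.
  have : accepts (fst' k) e x (snd' k).
    by have := good 0; rewrite /bad !pairE negb_or negbK => /andP[].
  apply: accepts_sound => i ne0.
  case E : (lhd (iter i ltl (snd' k))) => [|t]; split=> //.
    move=> /W_run[m Hm]; have := good (pair i m).
    by rewrite /bad /look !pairE ne0 E eqxx Hm orbT.
  move=> _; apply/W_run; exists t; have := good (pair i 0).
  by rewrite /bad /look !pairE ne0 E /= negb_or !negbK => /andP[].
move=> /accepts_complete[N HN].
(* True claims are chosen for all [i] at once and later cut off at the use bound [N]. *)
have [w Hw] : exists w : nat -> nat, forall i,
    (w i = 0 /\ ~ jump A i) \/ exists2 t, w i = t.+1 & run A t i i.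
  apply: (choice (fun i y => (y = 0 /\ ~ jump A i) \/ exists2 t, y = t.+1 & run A t i i)).
  move=> i; case: (classic (jump A i)) => [/W_run[t Ht]|nJ]; last by exists 0; left.
  by exists t.+1; right; exists t.
have [||n Hn] := HN (seg w N).
- move=> i /seg_end/(seg_lookup w)[_ ->].
  case: (Hw i) => [[-> nJ]|[t -> Ht]]; split=> // _; by apply/W_run; exists t.
- by move=> i /(seg_lookup w)[].
exists (pair n (seg w N)) => /qE[m]; rewrite /bad /look !pairE Hn /=.
case/andP => /seg_end/(seg_lookup w)[_ ->].
case: (Hw (fst' m)) => [[-> nJ]|[t -> Ht]] /=; last by rewrite Ht.
by move=> H; apply: nJ; apply/W_run; exists (snd' m).
Qed.

Lemma W_zero2_Sigma3 : exists r, (forall B, rec_in B r) /\ forall e x,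
  W zero2 e x <-> exists k, forall a, jump emptyset (r (pair (pair (pair e x) k) a)).
Proof.
have [q1 [Hq1 q1E]] := W_jump (jump emptyset).
have [q0 [Hq0 q0E]] := W_jump emptyset.
(* The value of [q1] occurs twice because membership in a jump runs a program on its own index. *)
exists (fun z => q0 (pair (pair (q1 (fst' z)) (q1 (fst' z))) (snd' z))).
split=> [B|e x]; first by solve_rec.
rewrite q1E; split=> -[k Hk]; exists k.
  move=> a; rewrite !pairE; apply: NNPP => nJ; apply: Hk; apply/q0E; by exists a.
by move=> /q0E[a]; apply; have := Hk a; rewrite !pairE.
Qed.

(** * The reductions *)

Lemma creducible_trans E F G : creducible E F -> creducible F G -> creducible E G.
Proof.
move=> [f [[cf Hf] fE]] [g [[cg Hg] gE]]; exists (fun x => g (f x)); split.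
  by exists (CComp cg cf) => x; apply: evComp (Hf x) (Hg _).
by move=> x y; rewrite fE gE.
Qed.

Lemma ce_W_comp A f g : rec_in A f -> rec_in A g -> ce A (fun z => W A (f z) (g z)).
Proof.
move=> Hf Hg; apply: (@ce_ext _ (fun z => W A (fst' (pair (f z) (g z))) (snd' (pair (f z) (g z))))).
  by move=> z; rewrite !pairE.
by apply: (ce_comp (ce_W A)); solve_rec.
Qed.

(** The failure of the inner universal statement is c.e. in [0'], so [0''] decides it and searches
    for [k]. *)
Lemma ce_zero2 (S : nat -> nat -> Prop) :
  ce (jump emptyset) (fun z => exists a, ~ S (pair (fst' z) (snd' z)) a) ->
  ce zero2 (fun x => exists k, forall a, S (pair k x) a).
Proof.
move=> H; apply: ce_ext (ce_jump (S := fun k x => exists a, ~ S (pair k x) a) H) => x.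
split=> -[k Hk]; exists k; last by move=> [a]; apply; exact: Hk.
by move=> a; apply: NNPP => nS; apply: Hk; exists a.
Qed.

Lemma E_Cof_le_E2_eq : creducible E_Cof E2_eq.
Proof.
(* Here [y] codes an index and a column number. Writing [m + x] replaces the condition [m <= x] in
   the definition of cofiniteness. *)
have : ce zero2 (fun y => exists m, forall x,
    W emptyset (fst' (snd' (pair m y)))
               (pair (fst' (pair m y) + x) (snd' (snd' (pair m y))))).
  apply: (ce_zero2 (S := fun y x => W emptyset (fst' (snd' y))
                            (pair (fst' y + x) (snd' (snd' y))))).
  apply: (ce_jump (S := fun x y => W emptyset (fst' (snd' (pair (fst' y) (snd' y))))
      (pair (fst' (pair (fst' y) (snd' y)) + x) (snd' (snd' (pair (fst' y) (snd' y))))))).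
  by apply: ce_W_comp; solve_rec.
case/smn => g [Hg gE]; exists g; split=> [|i j]; first exact: Hg.
have E e n : W zero2 (g e) n <-> cofinite (column (Wce e) n).
  rewrite gE; split=> -[m Hm]; exists m => x.
    by move=> le; have := Hm (x - m); rewrite !pairE subnKC.
  by rewrite !pairE; apply: Hm; exact: leq_addr.
by split=> H n; have := H n; rewrite !E.
Qed.

(** Every column is c.e. and hence has an index, so the collection of columns is determined by the
    set of all indices of its members. *)
Lemma E_set_le_E2_eq : creducible E_set E2_eq.
Proof.
have [h [Hh hE]] := jump_complete (ce_W emptyset).
(* [y] codes [n], [i] and [e] in this order, for the question whether [W_e] is column [n] of [W_i].
   As an equivalence of two c.e. statements, [T] is decided by [0']. *)
pose T y x := W emptyset (snd' (snd' y)) x <-> W emptyset (fst' (snd' y)) (pair x (fst' y)).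
have : ce zero2 (fun y => exists n, forall x, T (pair n y) x).
  apply: ce_zero2.
  apply: (@ce_ext _ (fun y => exists x, chi (jump emptyset) (h (pair (snd' (snd' y)) x))
            != chi (jump emptyset) (h (pair (fst' (snd' y)) (pair x (fst' y)))))).
    move=> y; rewrite pair_surj; split=> -[x Hx]; exists x.
      move=> Txy; move/eqP: Hx; apply.
      have := hE (pair (snd' (snd' y)) x).
      have := hE (pair (fst' (snd' y)) (pair x (fst' y))); rewrite !pairE.
      by rewrite /chi; do 2 case: excluded_middle_informative => ?; rewrite /T in Txy; intuition.
    apply/negP => /eqP Ec; apply: Hx; rewrite /T.
    have := hE (pair (snd' (snd' y)) x).
    have := hE (pair (fst' (snd' y)) (pair x (fst' y))); rewrite !pairE => <- <-.
    by rewrite -!chiP Ec.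
  by apply: ce_exists; solve_rec.
case/smn => g [Hg gE]; exists g; split=> [|i j]; first exact: Hg.
have E i' e : W zero2 (g i') e <-> exists n, set_eq (Wce e) (column (Wce i') n).
  rewrite gE; split=> -[n Hn]; exists n => x; have := Hn x; by rewrite /T !pairE.
have colE i' n : exists e, set_eq (Wce e) (column (Wce i') n).
  have /smn[f [_ fE]] : ce emptyset (fun z => W emptyset i' (pair (snd' z) n)).
    by apply: ce_W_comp; solve_rec.
  by exists (f 0) => x; rewrite /Wce fE pairE.
split.
  move=> [H1 H2] e; rewrite !E; split=> -[n Hn].
    by have [m Hm] := H1 n; exists m => x; rewrite Hn Hm.
  by have [m Hm] := H2 n; exists m => x; rewrite Hn Hm.
move=> H; split=> n.
  have [e He] := colE i n; have /E[m Hm] : W zero2 (g j) e by apply/H/E; exists n.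
  by exists m => x; rewrite -He Hm.
have [e He] := colE j n; have /E[m Hm] : W zero2 (g i) e by apply/H/E; exists n.
by exists m => x; rewrite -He Hm.
Qed.

(* If [f] takes no value infinitely often, then the last place where [f] takes *)
(* its minimum over a tail is not followed by any smaller or equal value. *)
Lemma cofinite_drop (f : nat -> nat) :
  cofinite (fun x => exists s, (x < s) && (f s <= f x)) <->
  exists v, forall N, exists s, N <= s /\ f s = v.
Proof.
have tail K : (forall v, v < K -> exists N, forall s, N <= s -> f s <> v) ->
    exists N, forall s, N <= s -> K <= f s.
  elim: K => [|K IH] H; first by exists 0.
  have [v lt|N1 H1] := IH; first by apply: H; lia.
  have [N2 H2] := H K (ltnSn _); exists (maxn N1 N2) => s; rewrite geq_max => /andP[l1 l2].
  by have := H1 s l1; have := H2 s l2; lia.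
split.
  move=> [m Hm]; apply: NNPP => nov.
  have fin v : exists N, forall s, N <= s -> f s <> v.
    apply: NNPP => H; apply: nov; exists v => N; apply: NNPP => H'; apply: H.
    by exists N => s le E; apply: H'; exists s.
  suff H v x : m <= x -> f x <= v -> False by apply: (H (f m) m).
  elim/ltn_ind: v x => v IH x le_mx le_fx.
  have [N HN] : exists N, forall s, N <= s -> v < f s.
    by apply: tail => u _; exact: fin.
  (* [p] bounds the distance to [N]: each use of [Hm] moves right and keeps [f] at most [v], but
     from [N] on all values exceed [v]. *)
  have [p Hp] : exists p, N - x <= p by exists (N - x).
  elim: p x le_mx le_fx Hp => [|p IHp] x le_mx le_fx Hp.
    by have := HN x; lia.
  have [s /andP[lt_xs le_fs]] := Hm x le_mx.
  by apply: (IHp s); lia.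
move=> [v Hv].
(* For the least infinitely recurring value [v0], [f] is eventually at least [v0], so every later
   return to [v0] is a witness. *)
have [v0 [Hv0 min0]] : exists v0, (forall N, exists s, N <= s /\ f s = v0) /\
    forall v, v < v0 -> exists N, forall s, N <= s -> f s <> v.
  elim/ltn_ind: v Hv => v IH Hv.
  case: (classic (exists2 u, u < v & forall N, exists s, N <= s /\ f s = u)).
    by move=> [u lt Hu]; apply: IH lt Hu.
  move=> no; exists v; split=> // u lt; apply: NNPP => H; apply: no; exists u => // N.
  apply: NNPP => H'; apply: H; exists N => s le E; apply: H'; by exists s.
have [N HN] := tail v0 min0; exists N => x le.
have [s [lt Es]] := Hv0 x.+1; exists s; rewrite lt Es; exact: HN.
Qed.

(** * Turning a universal statement into infinitely many events *)

Lemma common_bound (D : nat -> nat -> bool) y :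
  (exists t, all (fun a => has (D a) (iota 0 t)) (iota 0 y)) <->
  forall a, a < y -> exists b, D a b.
Proof.
split=> [[t /allP H] a lt|H].
  have /hasP[b _ Hb] : has (D a) (iota 0 t) by apply: H; rewrite mem_iota.
  by exists b.
elim: y H => [|y IH] H; first by exists 0.
have [a lt|t /allP Ht] := IH; first by apply: H; exact: ltnW.
have [b Hb] := H y (ltnSn _); exists (maxn t b.+1); apply/allP => a.
rewrite mem_iota add0n leq0n ltnS leq_eqVlt => /orP[/eqP->|lt].
  by apply/hasP; exists b => //; rewrite mem_iota; lia.
have /hasP[c] : has (D a) (iota 0 t) by apply: Ht; rewrite mem_iota.
rewrite mem_iota => lt_c Hc; apply/hasP; exists c => //; rewrite mem_iota; lia.
Qed.

(** [t.+1] is the least bound under which every number up to [a] has a witness, so [a] has at most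
    one event. *)
Definition event (D : nat -> nat -> bool) a t :=
  all (fun a => has (D a) (iota 0 t.+1)) (iota 0 a.+1) &&
  ~~ all (fun a => has (D a) (iota 0 t)) (iota 0 a.+1).

Lemma event_uniq D a t t' : event D a t -> event D a t' -> t = t'.
Proof.
have mono u v : u <= v -> all (fun a => has (D a) (iota 0 u)) (iota 0 a.+1) ->
    all (fun a => has (D a) (iota 0 v)) (iota 0 a.+1).
  move=> le; apply: sub_all => c /hasP[b Hb Db]; apply/hasP; exists b => //.
  by move: Hb; rewrite !mem_iota; lia.
move=> /andP[H1 H2] /andP[H3 H4]; case: (ltngtP t t') => // lt.
  by rewrite (mono _ _ lt H1) in H4.
by rewrite (mono _ _ lt H3) in H2.
Qed.

(** Each [a] contributes at most one event, so infinitely many events require arbitrarily large [a],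
    and an event at [a] supplies witnesses for all numbers up to [a]. *)
Lemma events_infinite D k :
  (forall N, exists s, N <= s /\ exists a t, s = pair k (pair a t) /\ event D a t) <->
  forall a, exists b, D a b.
Proof.
split=> [inf a | H N].
  have [N HN] : exists N, forall a' t, a' < a -> event D a' t -> pair k (pair a' t) < N.
    elim: a => [|a [N HN]]; first by exists 0.
    case: (classic (exists t, event D a t)) => [[t Ht]|no].
      exists (maxn N (pair k (pair a t)).+1) => a' t'; rewrite ltnS leq_eqVlt.
      case/orP => [/eqP->|lt] Ht'; first by rewrite (event_uniq Ht' Ht); lia.
      by have := HN a' t' lt Ht'; lia.
    exists N => a' t'; rewrite ltnS leq_eqVlt => /orP[/eqP->|lt] Ht'; last exact: HN.
    by case: no; exists t'.
  have [s [le [a' [t [E ev]]]]] := inf N.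
  case: (ltnP a' a) => lt; first by have := HN _ _ lt ev; lia.
  by case/andP: ev => ev _; apply: (common_bound D a'.+1).1 => //; exists t.+1.
have /common_bound exT : forall a, a < N.+1 -> exists b, D a b by move=> a _; exact: H.
case: (ex_minnP exT) => -[|t] Ht min_t; first by [].
exists (pair k (pair N t)); split.
  by apply: leq_trans (leq_pairl N t) _; exact: leq_pairr.
exists N, t; split=> //; rewrite /event Ht; apply/negP => /min_t; by rewrite ltnn.
Qed.

Section Sigma3.

Variable r : nat -> nat.
Hypothesis Hr : forall B, rec_in B r.
Hypothesis rE : forall e x,
  W zero2 e x <-> exists k, forall a, jump emptyset (r (pair (pair (pair e x) k) a)).

(** [b] codes a stage at which [r (pair u a)] is seen to enter [0'], which makes the innermost
    matrix decidable. *)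
Definition wit u a b := run emptyset b (r (pair u a)) (r (pair u a)).

Lemma witP e x : W zero2 e x <-> exists k, forall a, exists b, wit (pair (pair e x) k) a b.
Proof.
rewrite rE; split=> -[k H]; exists k => a; have := H a; by rewrite /jump W_run.
Qed.

(** Here [s] codes [k], [a] and [t]. Events of [k] get the value [k]; every other [s] gets itself,
    which adds each value at most once. *)
Definition rank u s :=
  if event (wit (pair u (fst' s))) (fst' (snd' s)) (snd' (snd' s)) then fst' s else s.

Lemma rank_infinite u :
  (exists v, forall N, exists s, N <= s /\ rank u s = v) <->
  exists k, forall a, exists b, wit (pair u k) a b.
Proof.
split=> -[v H]; exists v.
  (* Beyond [v] the default value [s] differs from [v], so only events can produce [v]. *)
  apply/(events_infinite _ v) => N; have [s [le]] := H (maxn N v.+1).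
  rewrite /rank; case: (boolP (event _ _ _)) => [ev E|_ E]; last lia.
  exists s; split; first lia.
  rewrite -E.
  by exists (fst' (snd' s)), (snd' (snd' s)); rewrite !pair_surj.
move=> N; have [s [le [a [t [E ev]]]]] := (events_infinite _ v).2 H N.
by exists s; split=> //; rewrite /rank E !pairE ev.
Qed.

Lemma rec_in_wit f g h : rec_in emptyset f -> rec_in emptyset g -> rec_in emptyset h ->
  rec_in emptyset (fun z => wit (f z) (g z) (h z)).
Proof. by move=> Hf Hg Hh; rewrite /wit; apply: rec_in_run; solve_rec. Qed.

Lemma rec_in_rank f g : rec_in emptyset f -> rec_in emptyset g ->
  rec_in emptyset (fun z => rank (f z) (g z)).
Proof.
by move=> Hf Hg; rewrite /rank /event; solve_rec; apply: rec_in_wit; solve_rec.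
Qed.

End Sigma3.

Lemma E2_eq_le_E_Cof : creducible E2_eq E_Cof.
Proof.
have [r [Hr rE]] := W_zero2_Sigma3.
(* [z] codes the index [e], the point [x] and the column [n]; the function depends on [e] and [n]
   only. *)
pose f z := rank r (pair (fst' z) (snd' (snd' z))).
have /smn[g [Hg gE]] : ce emptyset (fun z => exists s,
    (fst' (snd' z) < s) && (f z s <= f z (fst' (snd' z)))).
  by apply: ce_exists; rewrite /f; solve_rec; apply: rec_in_rank; solve_rec.
exists g; split; first exact: Hg.
have E e n : cofinite (column (Wce (g e)) n) <-> W zero2 e n.
  rewrite (witP rE) -(rank_infinite r (pair e n)) -cofinite_drop.
  split=> -[m H]; exists m => x /H; rewrite /column /Wce gE /f !pairE //.
by move=> i j; split=> H n; have := H n; rewrite !E.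
Qed.

Lemma E2_eq_le_E_set : creducible E2_eq E_set.
Proof.
have [r [Hr rE]] := W_zero2_Sigma3.
(* [z] codes the index, the point [w] and the column number [p], which consists of a tag, [n] and
   [k]. Tag [0] gives the segment of length [k]; any other tag gives the search for witnesses,
   bounded by [t]. *)
pose Q z t := let: w := fst' (snd' z) in let: p := snd' (snd' z) in
  (snd' w == fst' (snd' p)) &&
  (if fst' p == 0 then fst' w < snd' (snd' p)
   else all (fun a => has (wit r (pair (pair (fst' z) (snd' w)) (snd' (snd' p))) a) (iota 0 t))
          (iota 0 (fst' w).+1)).
have /smn[g [Hg gE]] : ce emptyset (fun z => exists t, Q z t).
  by apply: ce_exists; rewrite /Q; solve_rec; apply: rec_in_wit; solve_rec.
exists g; split; first exact: Hg.
have E0 e n k w : column (Wce (g e)) (pair 0 (pair n k)) w <-> snd' w = n /\ fst' w < k.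
  rewrite /column /Wce gE /Q !pairE /=; split=> [[_ /andP[/eqP-> ->]] //|[-> ->]].
  by exists 0; rewrite eqxx.
have E1 e n k c w : column (Wce (g e)) (pair c.+1 (pair n k)) w <->
    snd' w = n /\ forall a, a < (fst' w).+1 -> exists b, wit r (pair (pair e n) k) a b.
  rewrite -common_bound /column /Wce gE /Q !pairE /=; split=> [[t /andP[/eqP<- H]]|[<- [t H]]].
    by split=> //; exists t.
  by exists t; rewrite eqxx.
move=> i j.
have colS i' j' : set_eq (W zero2 i') (W zero2 j') -> forall n, exists m,
    set_eq (column (Wce (g i')) n) (column (Wce (g j')) m).
  move=> H p; rewrite -(pair_surj p) -(pair_surj (snd' p)).
  move: (fst' p) (fst' (snd' p)) (snd' (snd' p)) => [|c] n k {p}.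
    by exists (pair 0 (pair n k)) => w; rewrite !E0.
  case: (classic (forall a, exists b, wit r (pair (pair i' n) k) a b)).
    move=> full.
    have /(witP rE)[k' full'] : W zero2 j' n by apply/H/(witP rE); exists k.
    by exists (pair 1 (pair n k')) => w; rewrite !E1; split=> -[].
  (* If some [a] lacks a witness, the column is the segment whose length is the least such [a]. *)
  move=> /not_all_ex_not[a]; elim/ltn_ind: a => a IH Ha.
  case: (classic (exists2 a', a' < a & ~ (exists b, wit r (pair (pair i' n) k) a' b))).
    by move=> [a' lt Ha']; exact: IH Ha'.
  move=> no; exists (pair 0 (pair n a)) => w; rewrite E0 E1; split=> -[-> Hw]; split=> //.
    by rewrite ltnNge; apply/negP => le; apply: Ha; apply: Hw.
  move=> b lt; apply: NNPP => nb; apply: no; exists b => //; lia.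
have colI i' j' : (forall n, exists m, set_eq (column (Wce (g i')) n) (column (Wce (g j')) m)) ->
    forall n, W zero2 i' n -> W zero2 j' n.
  move=> H n /(witP rE)[k full]; have [p Hp] := H (pair 1 (pair n k)).
  have {}Hp y : column (Wce (g j')) p (pair y n) by apply/Hp/E1; rewrite !pairE.
  move: Hp; rewrite -(pair_surj p) -(pair_surj (snd' p)).
  move: (fst' p) (fst' (snd' p)) (snd' (snd' p)) => [|c] n' k' {p} Hp.
    (* A segment of length [k'] omits the point of height [k'], so it is not the full line. *)
    by have /E0 := Hp k'; rewrite !pairE ltnn => -[].
  have /E1[] := Hp 0; rewrite pairE => En _; subst n'.
  apply/(witP rE); exists k' => a; have /E1[_] := Hp a; rewrite pairE; exact.
have symm S T : set_eq S T -> set_eq T S by move=> H x; rewrite H.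
split=> [H|[H1 H2] n].
  split=> n; first exact: colS.
  by have [m Hm] := colS _ _ (symm _ _ H) n; exists m; exact: symm.
split; apply: colI => // m; have [p Hp] := H2 m; by exists p; exact: symm.
Qed.

Theorem theorem2p4 :
  cbireducible E_Cof E_set /\ cbireducible E_set E2_eq /\ cbireducible E_Cof E2_eq.
Proof.
have [a b c d] := And4 E_Cof_le_E2_eq E_set_le_E2_eq E2_eq_le_E_Cof E2_eq_le_E_set.
by split; [|split]; split => //; [apply: creducible_trans a d | apply: creducible_trans b c].
Qed.
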